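(* Let $\mathbb{F}_q$ be a finite field of constant prime order $q$, and let $C(\bar x)$ be an algebraic circuit of depth $\Delta$ over $\mathbb{F}_q$ in the variables $\bar x$. Then $$\{x^q-x=0 : x\text{ a variable of }C\},\ C(\bar x)=0\ \vdash^{*,O(\Delta)}_{\mathrm{IPS}^{\mathrm{alg}}}\ \mathrm{SCNF}(C(\bar x)=0).$$
   Context: $\mathcal{A}\vdash^{*,O(\Delta)}_{\mathrm{IPS}^{\mathrm{alg}}}\mathcal{B}$ means every equation $p=0$ in $\mathcal{B}$ has an $\mathrm{IPS}^{\mathrm{alg}}$ proof from $\mathcal{A}=\{f_j=0\}_{j\in[m]}$ of size polynomial in $|C|$ and depth $O(\Delta)$, where an $\mathrm{IPS}^{\mathrm{alg}}$ proof is an algebraic circuit $D(\bar v,t_1,\dots,t_m)$ with $\hat D(\bar v,\bar0)=0$ and $\hat D(\bar v,f_1,\dots,f_m)=p$ (no Boolean axioms are added). $\mathrm{UBIT}_j(h)=\prod_{i\ne j}(h-i)/\prod_{i\ne j}(j-i)$ ($i,j\in\{0,\dots,q-1\}$). Plain CNF encoding $\mathrm{cnf}(C(\bar x)=0)$: each gate and auxiliary node $g$ has unary bits $x_{g0},\dots,x_{g(q-1)}$. For each input variable $x_i$: clause $\bigvee_jx_{x_ij}$ and clauses $\neg x_{x_ij}\vee\neg x_{x_il}$ ($j\ne l$). Scalar inputs contribute their constant unary bits. A gate $g$ of type $\circ\in\{+,\times\}$ with inputs $u_1,\dots,u_t$ is decomposed into $u_1\circ u_2=v^g_1$, $u_{i+2}\circ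 v^g_i=v^g_{i+1}$ ($1\le i\le t-3$), $u_t\circ v^g_{t-2}=g$; each binary equation $a\circ b=c$ gets a CNF in the unary bits of $a,b,c$ satisfied exactly when the bits of $c$ are correct per the truth table of $\circ$ over $\mathbb{F}_q$ (and unsatisfiable if more than one bit of $a$, $b$ or $c$ is $1$). Also Boolean axioms $x_{gi}^2-x_{gi}=0$, and $x_{g_{out}0}=1$, $x_{g_{out}i}=0$ ($i\ge1$) for the output gate. Clauses $\bigvee_{i\in P}v_i\vee\bigvee_{j\in N}\neg v_j$ are written as equations $\prod_{i\in P}(1-v_i)\prod_{j\in N}v_j=0$. $\mathrm{SCNF}(C(\bar x)=0)$ is obtained from $\mathrm{cnf}(C(\bar x)=0)$ by substituting every unary bit $x_{uj}$ by $\mathrm{UBIT}_j(C_u)$, where $C_u$ is the constant-depth algebraic circuit (built from $C$) computing the value of node $u$. *)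

(* Defs.v *)
From HB Require Import structures.
From mathcomp Require Import all_boot all_order all_algebra.
From mathcomp.multinomials Require Import mpoly.

Set Implicit Arguments.
Unset Strict Implicit.
Unset Printing Implicit Defensive.

Import GRing.Theory.
Local Open Scope ring_scope.

Inductive gate_op := Plus | Times.

Definition op_fun (R : nzRingType) (o : gate_op) : R -> R -> R :=
  match o with Plus => +%R | Times => *%R end.

(* An algebraic circuit is a DAG given in topological order: a gate refers to
   its inputs, with multiplicity, by their positions in [nodes], and [out] is
   the position of the output node. *)
Inductive node (F : Type) (n : nat) :=
  | Var of 'I_n
  | Scal of F
  | Gate of gate_op & seq nat.

Record circuit (F : Type) (n : nat) :=
  Circuit { nodes : seq (node F n); out : nat }.

Section Circuits.
Variables (F : fieldType) (n : nat).
Implicit Type (C : circuit F n).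

Definition node_at C (k : nat) : node F n := nth (Scal n 0) (nodes C) k.

Definition inputs (nd : node F n) : seq nat :=
  if nd is Gate _ us then us else [::].

Definition node_wf (k : nat) (nd : node F n) : bool :=
  if nd is Gate _ us then (1 < size us)%N && all (fun u => u < k)%N us
  else true.

Definition circuit_wf C : bool :=
  (out C < size (nodes C))%N &&
  all (fun k => node_wf k (node_at C k)) (iota 0 (size (nodes C))).

(* Number of nodes plus number of wires. *)
Definition csize C : nat := (\sum_(nd <- nodes C) (size (inputs nd)).+1)%N.

Definition node_depth (ds : seq nat) (nd : node F n) : nat :=
  if nd is Gate _ us then (\max_(u <- us) nth 0 ds u).+1%N else 0%N.

Definition depths C : seq nat :=
  foldl (fun ds nd => rcons ds (node_depth ds nd)) [::] (nodes C).

(* Length, in wires, of a longest directed path. *)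
Definition cdepth C : nat := (\max_(d <- depths C) d)%N.

Definition node_poly (ps : seq {mpoly F[n]}) (nd : node F n) : {mpoly F[n]} :=
  match nd with
  | Var i => 'X_i
  | Scal a => a%:MP
  | Gate Plus us => \sum_(u <- us) ps`_u
  | Gate Times us => \prod_(u <- us) ps`_u
  end.

Definition polys C : seq {mpoly F[n]} :=
  foldl (fun ps nd => rcons ps (node_poly ps nd)) [::] (nodes C).

Definition cpoly C : {mpoly F[n]} := (polys C)`_(out C).

Definition vars C : seq 'I_n :=
  [seq i <- enum 'I_n
     | has (fun nd => if nd is Var i' then i' == i else false) (nodes C)].

End Circuits.

Section IPS.
Variables (F : fieldType) (n : nat).

(* The first n variables of D are the original ones, variable n + j is the
   placeholder of the j-th axiom. *)
Definition ips_subst (m : nat) (ts : 'I_m -> {mpoly F[n]}) :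
    (n + m).-tuple {mpoly F[n]} :=
  [tuple match split i with inl x => 'X_x | inr j => ts j end | i < n + m].

Definition ips_alg_proof (fs : seq {mpoly F[n]}) (p : {mpoly F[n]})
    (D : circuit F (n + size fs)) : Prop :=
  cpoly D \mPo ips_subst (fun _ => 0) = 0 /\
  cpoly D \mPo ips_subst (fun j => fs`_j) = p.

End IPS.

Arguments ips_alg_proof {F n} fs p D.

Section UnaryEncoding.
Variable q : nat.

Definition ubit_poly (n : nat) (j : 'I_q) (h : {mpoly 'F_q[n]}) :
    {mpoly 'F_q[n]} :=
  (\prod_(i < q | i != j) ((j%:R : 'F_q) - i%:R))^-1
    *: \prod_(i < q | i != j) (h - i%:R).

Definition triple (B : Type) (a b c : B) (r : 'I_3) : B :=
  nth a [:: a; b; c] r.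

(* A CNF in the unary bits of the three nodes of an equation a o b = c: the
   variable (r, j) is the j-th bit of a, b or c, for r = 0, 1, 2.  A clause is
   the pair of the sets of its positive and of its negated variables. *)
Definition clause3 := ({set 'I_3 * 'I_q} * {set 'I_3 * 'I_q})%type.
Definition cnf3 := {set clause3}.

Definition sat3 (s : 'I_3 -> 'I_q -> bool) (T : cnf3) : bool :=
  [forall cl in T, [exists v in cl.1, s v.1 v.2] ||
                   [exists v in cl.2, ~~ s v.1 v.2]].

Definition unary (a : 'F_q) : 'I_q -> bool := fun j => j%:R == a.

(* Any CNF meeting these two conditions is admissible; nothing is asked of
   assignments in which no bit of a, or no bit of b, is 1. *)
Definition truth_table_cnf (o : gate_op) (T : cnf3) : Prop :=
  (forall (x y : 'F_q) (c : 'I_q -> bool),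
     sat3 (triple (unary x) (unary y) c) T <-> c =1 unary (op_fun o x y)) /\
  (forall s : 'I_3 -> 'I_q -> bool,
     (exists r j l, [/\ j != l, s r j & s r l]) -> ~~ sat3 s T).

Section Encoding.
Variable n : nat.

(* The nodes carrying unary bits: input variables, gates of the circuit (by
   position), and auxiliary nodes; [BAux g i] is v^g_i, with i >= 1. *)
Inductive bnode := BVar of 'I_n | BGate of nat | BAux of nat & nat.

Inductive ubit := Bit of bnode & 'I_q | CstBit of bool.

Inductive cnf_eq :=
  | Clause of seq ubit & seq ubit
  | BooleanAxiom of ubit
  | FixBit of ubit & bool.

Variable C : circuit 'F_q n.

Definition node_bits (k : nat) : 'I_q -> ubit :=
  match node_at C k with
  | Var i => Bit (BVar i)
  | Scal a => fun j => CstBit (unary a j)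
  | Gate _ _ => Bit (BGate k)
  end.

Definition inst_clause (bits : 'I_3 -> 'I_q -> ubit) (cl : clause3) : cnf_eq :=
  Clause [seq bits v.1 v.2 | v <- enum cl.1]
         [seq bits v.1 v.2 | v <- enum cl.2].

(* The i-th of the t - 1 binary equations of gate g, 0 <= i < t - 1, where us
   are the t inputs (so that u_(i+2) is at position i + 1). *)
Definition binary_bits (g : nat) (us : seq nat) (i : nat) :
    'I_3 -> 'I_q -> ubit :=
  triple
    (if i == 0%N then node_bits (nth 0%N us 0) else node_bits (nth 0%N us i.+1))
    (if i == 0%N then node_bits (nth 0%N us 1) else Bit (BAux g i))
    (if i.+1 == (size us).-1 then Bit (BGate g) else Bit (BAux g i.+1)).

Definition var_eqs (i : 'I_n) : seq cnf_eq :=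
  Clause [seq Bit (BVar i) j | j <- enum 'I_q] [::] ::
  [seq Clause [::] [:: Bit (BVar i) jl.1; Bit (BVar i) jl.2]
     | jl <- enum {: 'I_q * 'I_q} & jl.1 != jl.2].

Definition gate_eqs (T : gate_op -> cnf3) (g : nat) : seq cnf_eq :=
  if node_at C g is Gate o us then
    [seq inst_clause (binary_bits g us i) cl
       | i <- iota 0 (size us).-1, cl <- enum (T o)]
  else [::].

Definition bnodes : seq bnode :=
  map BVar (vars C) ++
  flatten [seq (if node_at C g is Gate _ us
                then BGate g :: map (BAux g) (iota 1 (size us).-2)
                else [::])
             | g <- iota 0 (size (nodes C))].

Definition boolean_eqs : seq cnf_eq :=
  [seq BooleanAxiom (Bit u j) | u <- bnodes, j <- enum 'I_q].

Definition out_eqs : seq cnf_eq :=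
  [seq FixBit (node_bits (out C) j) (j == 0%N :> nat) | j <- enum 'I_q].

Definition cnf (T : gate_op -> cnf3) : seq cnf_eq :=
  flatten [seq var_eqs i | i <- vars C] ++
  flatten [seq gate_eqs T g | g <- iota 0 (size (nodes C))] ++
  boolean_eqs ++ out_eqs.

(* The circuit C_u; the auxiliary node v^g_i has the value
   u_1 o ... o u_(i+1). *)
Definition bnode_circuit (u : bnode) : circuit 'F_q n :=
  match u with
  | BVar i => Circuit [:: Var _ i] 0
  | BGate g => Circuit (nodes C) g
  | BAux g i =>
      if node_at C g is Gate o us then
        Circuit (rcons (nodes C) (Gate _ _ o (take i.+1 us))) (size (nodes C))
      else C
  end.

Definition subst_ubit (b : ubit) : {mpoly 'F_q[n]} :=
  match b with
  | Bit u j => ubit_poly j (cpoly (bnode_circuit u))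
  | CstBit b => b%:R
  end.

(* The polynomial p of the equation p = 0, after the substitution. *)
Definition subst_eq (e : cnf_eq) : {mpoly 'F_q[n]} :=
  match e with
  | Clause P N =>
      \prod_(v <- P) (1 - subst_ubit v) * \prod_(v <- N) subst_ubit v
  | BooleanAxiom v => subst_ubit v ^+ 2 - subst_ubit v
  | FixBit v b => subst_ubit v - b%:R
  end.

Definition scnf (T : gate_op -> cnf3) : seq {mpoly 'F_q[n]} :=
  map subst_eq (cnf T).

Definition circuit_axioms : seq {mpoly 'F_q[n]} :=
  rcons [seq 'X_i ^+ q - 'X_i | i <- vars C] (cpoly C).

End Encoding.
End UnaryEncoding.

(* Main.v *)
(** Over [F_q] the Frobenius map gives [h(x)^q = h(x^q)] for every polynomial
    [h], so [h(x + t) - h(x)], with [t_i] the placeholder of [x_i^q - x_i], is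
    an IPS proof of [h^q - h = 0] that only copies the circuit of [h] twice.

    Apart from the output equations, every equation of the SCNF has the form
    [P(h_1, ..., h_m) = 0] with [m <= 2], where [P] is one of finitely many
    polynomials depending on [q] only, [P] vanishes on [F_q^m] and the [h_i] are
    values of nodes.  With [U_s] the product of the unary bits [UBIT_(s_i)(h_i)],
    the [U_s] sum to [1], hence [P = sum_s (P - P(s)) U_s], and each term is
    generated by the [h_i^q - h_i] since
    [(h - j) UBIT_j(h) = c_j (h^q - h)].  This yields an expression
    [E(h, h')] of constant size with [E(h, h) = 0] and [E(h, h^q) = P(h)], and
    the proof is [D(x, t) = E(h(x), h(x + t))].

    An output equation is [P(C(x)) = 0] with [P(0) = 0]; its proof is [P(t)],
    where [t] is the placeholder of the axiom [C(x) = 0]. *)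

Require Import Defs.
From HB Require Import structures.
From mathcomp Require Import all_boot all_order all_algebra.
From mathcomp Require Import finfield ring.
From mathcomp.multinomials Require Import mpoly.
From mathcomp Require Import zify.

Set Implicit Arguments.
Unset Strict Implicit.
Unset Printing Implicit Defensive.

Import GRing.Theory.
Local Open Scope ring_scope.

(** * Sequences in which each entry is computed from the earlier ones *)

Section Scan.
Variables (A B : Type) (f : seq B -> A -> B).

(** Common shape of [polys] and [depths], both convertible to instances of it. *)
Definition scan (s : seq A) : seq B :=
  foldl (fun bs a => rcons bs (f bs a)) [::] s.

Lemma scan_rcons s a : scan (rcons s a) = rcons (scan s) (f (scan s) a).
Proof. by rewrite /scan foldl_rcons. Qed.

Lemma size_scan s : size (scan s) = size s.
Proof. by elim/last_ind: s => // s a IHs; rewrite scan_rcons !size_rcons IHs. Qed.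

Lemma nth_scan_rcons b0 s a k :
  nth b0 (scan (rcons s a)) k =
  if (k < size s)%N then nth b0 (scan s) k
  else if k == size s then f (scan s) a else b0.
Proof. by rewrite scan_rcons nth_rcons size_scan. Qed.

(** An entry depends only on the prefix before it. Circuits can therefore be built by appending
    nodes, with the positions and values of the old nodes unchanged. *)
Lemma nth_scan_cat b0 s t k :
  (k < size s)%N -> nth b0 (scan (s ++ t)) k = nth b0 (scan s) k.
Proof.
move=> lt_ks; elim/last_ind: t => [|t a IHt]; first by rewrite cats0.
by rewrite -rcons_cat nth_scan_rcons size_cat ltn_addr.
Qed.

End Scan.

Lemma all_iota_nth_rcons (A : Type) (P : nat -> A -> bool) (x0 : A) s a :
  all (fun k => P k (nth x0 (rcons s a) k)) (iota 0 (size (rcons s a))) =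
  all (fun k => P k (nth x0 s k)) (iota 0 (size s)) && P (size s) a.
Proof.
rewrite size_rcons -addn1 iotaD all_cat /= andbT add0n nth_rcons ltnn eqxx.
congr (_ && _); apply: eq_in_all => k; rewrite mem_iota /= => lt_k.
by rewrite nth_rcons lt_k.
Qed.

(** * Well-formedness, size and depth of node sequences *)

Section NodeSequences.
Variables (F : fieldType) (n : nat).
Implicit Types (s t : seq (node F n)) (nd : node F n).

Definition nodes_wf s :=
  all (fun k => node_wf k (nth (Scal n 0) s k)) (iota 0 (size s)).

Definition nsize s := (\sum_(nd <- s) (size (inputs nd)).+1)%N.

Definition ndepth s k := nth 0%N (scan (@node_depth F n) s) k.

Definition maxdepth s := (\max_(d <- scan (@node_depth F n) s) d)%N.

Definition has_var (i : 'I_n) s :=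
  has (fun nd => if nd is Var i' then i' == i else false) s.

Lemma nodes_wf_rcons s nd :
  nodes_wf (rcons s nd) = nodes_wf s && node_wf (size s) nd.
Proof. exact: all_iota_nth_rcons. Qed.

Lemma nsize_rcons s nd : nsize (rcons s nd) = (nsize s + (size (inputs nd)).+1)%N.
Proof. by rewrite /nsize big_rcons /=. Qed.

Lemma nsize_cat s t : nsize (s ++ t) = (nsize s + nsize t)%N.
Proof. by rewrite /nsize big_cat. Qed.

Lemma size_le_nsize s : (size s <= nsize s)%N.
Proof.
elim/last_ind: s => // s nd IHs.
by rewrite nsize_rcons size_rcons addnS ltnS (leq_trans IHs) ?leq_addr.
Qed.

Lemma maxdepth_rcons s nd :
  maxdepth (rcons s nd) =
  maxn (maxdepth s) (node_depth (scan (@node_depth F n) s) nd).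
Proof. by rewrite /maxdepth scan_rcons big_rcons. Qed.

Lemma ndepth_le_max s k : (ndepth s k <= maxdepth s)%N.
Proof.
rewrite /ndepth; have [lt_ks|le_sk] := ltnP k (size (scan (@node_depth F n) s)).
  by apply: (@leq_bigmax_seq _ _ predT id) => //; apply: mem_nth.
by rewrite nth_default.
Qed.

Lemma gate_depth_le s o us d :
  (forall u, u \in us -> ndepth s u <= d)%N ->
  (node_depth (scan (@node_depth F n) s) (Gate F n o us) <= d.+1)%N.
Proof.
move=> le_d; rewrite /= ltnS; apply/bigmax_leqP_seq => u u_us _.
exact: le_d.
Qed.

Lemma maxdepth_rcons_le s nd : (maxdepth (rcons s nd) <= (maxdepth s).+1)%N.
Proof.
rewrite maxdepth_rcons geq_max leqnSn /=; case: nd => // o us.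
by apply: gate_depth_le => u _; apply: ndepth_le_max.
Qed.

Lemma ndepth_rcons s nd k :
  ndepth (rcons s nd) k =
  if (k < size s)%N then ndepth s k
  else if k == size s then node_depth (scan (@node_depth F n) s) nd else 0%N.
Proof. by rewrite /ndepth nth_scan_rcons. Qed.

Lemma ndepth_cat s t k : (k < size s)%N -> ndepth (s ++ t) k = ndepth s k.
Proof. exact: nth_scan_cat. Qed.

Lemma has_var_rcons i s nd :
  has_var i (rcons s nd) =
  has_var i s || (if nd is Var i' then i' == i else false).
Proof. by rewrite /has_var has_rcons orbC. Qed.

End NodeSequences.

(** * Evaluation of circuits in commutative algebras over the base field *)

Section Values.
Variables (F : fieldType) (R : comNzRingType) (iota : {rmorphism F -> R}).

Definition node_val n (v : 'I_n -> R) (xs : seq R) (nd : node F n) : R :=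
  match nd with
  | Var i => v i
  | Scal a => iota a
  | Gate Plus us => \sum_(u <- us) xs`_u
  | Gate Times us => \prod_(u <- us) xs`_u
  end.

Definition vals n (v : 'I_n -> R) s := scan (node_val v) s.

Lemma vals_rcons n (v : 'I_n -> R) s nd k :
  (vals v (rcons s nd))`_k =
  if (k < size s)%N then (vals v s)`_k
  else if k == size s then node_val v (vals v s) nd else 0.
Proof. exact: nth_scan_rcons. Qed.

Lemma vals_cat n (v : 'I_n -> R) s t k :
  (k < size s)%N -> (vals v (s ++ t))`_k = (vals v s)`_k.
Proof. exact: nth_scan_cat. Qed.

(** Restricting to the variables that occur matters because only these have an axiom
    [x^q - x = 0]. *)
Lemma vals_ext n (v w : 'I_n -> R) s k :
  (forall i, has_var i s -> v i = w i) -> (vals v s)`_k = (vals w s)`_k.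
Proof.
suff eq_s: (forall i, has_var i s -> v i = w i) -> vals v s = vals w s.
  by move/eq_s->.
elim/last_ind: s => // s nd IHs eq_vw.
rewrite /vals !scan_rcons -!/(vals _ _) IHs => [|i s_i]; last first.
  by apply: eq_vw; rewrite has_var_rcons s_i.
congr rcons; case: nd eq_vw => //= i eq_vw.
by apply: eq_vw; rewrite has_var_rcons eqxx orbT.
Qed.

End Values.

(** Sums and products commute with ring morphisms, node by node. Used twice: for composition of
    polynomials and for the Frobenius map. *)
Lemma rmorph_vals (F : fieldType) (R S : comNzRingType)
    (iota : {rmorphism F -> R}) (kappa : {rmorphism F -> S})
    (phi : {rmorphism R -> S}) n (v : 'I_n -> R) s k :
  (forall a, phi (iota a) = kappa a) ->
  phi (vals iota v s)`_k = (vals kappa (phi \o v) s)`_k.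
Proof.
move=> phi_iota; suff ->: vals kappa (phi \o v) s = map phi (vals iota v s).
  have [lt_k|le_k] := ltnP k (size (vals iota v s)); first by rewrite (nth_map 0).
  by rewrite !nth_default ?size_map // rmorph0.
have nth_phi (xs : seq R) u : (map phi xs)`_u = phi xs`_u.
  have [lt_u|le_u] := ltnP u (size xs); first by rewrite (nth_map 0).
  by rewrite !nth_default ?size_map // rmorph0.
elim/last_ind: s => // s nd IHs.
rewrite /vals !scan_rcons -!/(vals _ _ _) IHs map_rcons; congr rcons.
case: nd => [i|a|[] us] //=; rewrite ?phi_iota //.
  by rewrite rmorph_sum; apply: eq_bigr => u _; rewrite nth_phi.
by rewrite rmorph_prod; apply: eq_bigr => u _; rewrite nth_phi.
Qed.

(** * Formulas over the values of already existing nodes *)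

Inductive expr (F X : Type) :=
  | EVar of X
  | ECst of F
  | EGate of gate_op & expr F X & expr F X.

Arguments EVar {F X}.
Arguments ECst {F X}.
Arguments EGate {F X}.

Section Expressions.
Variables (F : fieldType) (X : Type).
Implicit Type e : expr F X.

Fixpoint eval (R : comNzRingType) (iota : F -> R) (v : X -> R) e : R :=
  match e with
  | EVar x => v x
  | ECst a => iota a
  | EGate o e1 e2 => op_fun o (eval iota v e1) (eval iota v e2)
  end.

(** The cost of appending [e] to a circuit: a variable points to an existing node, a constant is one
    new node, and a gate is one node with two wires. *)
Fixpoint esize e : nat :=
  match e with
  | EVar _ => 0
  | ECst _ => 1
  | EGate _ e1 e2 => (esize e1 + esize e2 + 3)%N
  end.

Fixpoint erename Y (f : X -> Y) e : expr F Y :=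
  match e with
  | EVar x => EVar (f x)
  | ECst a => ECst a
  | EGate o e1 e2 => EGate o (erename f e1) (erename f e2)
  end.

Definition esum I (r : seq I) (f : I -> expr F X) :=
  foldr (fun i => EGate Plus (f i)) (ECst 0) r.
Definition eprod I (r : seq I) (f : I -> expr F X) :=
  foldr (fun i => EGate Times (f i)) (ECst 1) r.

Section Eval.
Variables (R : comNzRingType) (iota : {rmorphism F -> R}).

Lemma eval_ext (v w : X -> R) e : v =1 w -> eval iota v e = eval iota w e.
Proof. by move=> eq_vw; elim: e => //= o e1 -> e2 ->. Qed.

Lemma eval_sum I (r : seq I) f (v : X -> R) :
  eval iota v (esum r f) = \sum_(i <- r) eval iota v (f i).
Proof. by elim: r => /= [|i r ->]; rewrite ?big_nil ?big_cons ?rmorph0. Qed.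

Lemma eval_prod I (r : seq I) f (v : X -> R) :
  eval iota v (eprod r f) = \prod_(i <- r) eval iota v (f i).
Proof. by elim: r => /= [|i r ->]; rewrite ?big_nil ?big_cons ?rmorph1. Qed.

End Eval.

Lemma rmorph_eval (R S : comNzRingType) (iota : F -> R) (kappa : F -> S)
    (phi : {rmorphism R -> S}) (v : X -> R) e :
  (forall a, phi (iota a) = kappa a) ->
  phi (eval iota v e) = eval kappa (phi \o v) e.
Proof.
move=> phi_iota; elim: e => //= o e1 <- e2 <-.
by case: o; rewrite ?rmorphD ?rmorphM.
Qed.

End Expressions.

Lemma eval_rename (F : fieldType) (X Y : Type) (f : X -> Y)
    (R : comNzRingType) (iota : F -> R) (v : Y -> R) (e : expr F X) :
  eval iota v (erename f e) = eval iota (v \o f) e.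
Proof. by elim: e => //= o e1 -> e2 ->. Qed.

(** * Building circuits by appending nodes *)

Section Building.
Variables (F : fieldType) (n : nat).
Implicit Types L M : seq (node F n).

(** The nodes are appended in postorder. The depth bound is crude, one level per unit of size, which
    suffices for expressions of constant size. *)
Lemma append_expr X (e : expr F X) L (p : X -> nat) :
  nodes_wf L -> (forall x, p x < size L)%N ->
  exists M k, [/\ nodes_wf (L ++ M), (k < size (L ++ M))%N,
    (nsize M <= esize e)%N, (maxdepth (L ++ M) <= maxdepth L + esize e)%N
    & forall (R : comNzRingType) (iota : {rmorphism F -> R}) v,
      (vals iota v (L ++ M))`_k = eval iota (fun x => (vals iota v L)`_(p x)) e].
Proof.
elim: e L => [x|a|o e1 IH1 e2 IH2] L wfL ltp.
- exists [::], (p x); rewrite cats0; split=> //.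
    by rewrite /nsize big_nil.
  by rewrite addn0.
- exists [:: Scal n a], (size L); rewrite cats1; split=> //.
  + by rewrite nodes_wf_rcons wfL.
  + by rewrite size_rcons.
  + by rewrite /nsize big_seq1.
  + by rewrite addn1 maxdepth_rcons_le.
  by move=> R iota v; rewrite vals_rcons ltnn eqxx.
have [M1 [k1 [wf1 lt1 sz1 d1 val1]]] := IH1 L wfL ltp.
have [|M2 [k2 [wf2 lt2 sz2 d2 val2]]] := IH2 (L ++ M1) wf1.
  by move=> x; rewrite size_cat ltn_addr.
exists (rcons (M1 ++ M2) (Gate F n o [:: k1; k2])), (size ((L ++ M1) ++ M2)).
have lt1': (k1 < size ((L ++ M1) ++ M2))%N by rewrite size_cat ltn_addr.
rewrite -rcons_cat catA; split=> [|||| R iota v].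
- by rewrite nodes_wf_rcons wf2 /= lt1' lt2.
- by rewrite size_rcons.
- by rewrite nsize_rcons nsize_cat /= leq_add // leq_add.
- apply: leq_trans (maxdepth_rcons_le _ _) _; move: d1 d2 => /=; lia.
have eq2: eval iota (fun x => (vals iota v (L ++ M1))`_(p x)) e2 =
          eval iota (fun x => (vals iota v L)`_(p x)) e2.
  by apply: eval_ext => x; rewrite vals_cat.
rewrite vals_rcons ltnn eqxx /=.
case: o; rewrite !(big_cons, big_nil) ?addr0 ?mulr1 /=.
  by rewrite (vals_cat _ _ _ lt1) val1 val2 eq2.
by rewrite (vals_cat _ _ _ lt1) val1 val2 eq2.
Qed.

(** A copy of [N] is appended in which each variable is replaced by a pointer into [L], so [f] need
    not be a shift. The depth is tracked node by node: a bound on the maximum alone would grow with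
    every gate in the induction. *)
Lemma append_subst m (N : seq (node F m)) L (sigma : 'I_m -> nat) :
  nodes_wf L -> nodes_wf N ->
  (forall i, has_var i N -> sigma i < size L)%N ->
  exists M f, [/\ nodes_wf (L ++ M), (nsize M <= nsize N)%N,
    (maxdepth (L ++ M) <= maxdepth L + maxdepth N)%N,
    (forall k, k < size N ->
       f k < size (L ++ M) /\
       ndepth (L ++ M) (f k) <= maxdepth L + ndepth N k)%N
    & forall k, (k < size N)%N ->
      forall (R : comNzRingType) (iota : {rmorphism F -> R}) v,
      (vals iota v (L ++ M))`_(f k) =
      (vals iota (fun i => (vals iota v L)`_(sigma i)) N)`_k].
Proof.
move=> wfL; elim/last_ind: N => [|N nd IHN].
  move=> _ _; exists [::], id; rewrite cats0.
  split=> //; last by rewrite leq_addr.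
  by rewrite /nsize !big_nil.
rewrite nodes_wf_rcons => /andP[wfN wf_nd] lt_sigma.
have [|M [f [wfM szM dM lt_f val_f]]] := IHN wfN.
  by move=> i Ni; apply: lt_sigma; rewrite has_var_rcons Ni.
pose g j k := if (k < size N)%N then f k else j.
(* Shared by scalars and gates: one node [nd'] of the same fan-in and value is appended as the copy
   of [nd]. *)
have appended nd' :
    node_wf (size (L ++ M)) nd' -> size (inputs nd') = size (inputs nd) ->
    (node_depth (scan (@node_depth F n) (L ++ M)) nd' <=
      maxdepth L + node_depth (scan (@node_depth F m) N) nd)%N ->
    (forall (R : comNzRingType) (iota : {rmorphism F -> R}) v,
      node_val iota v (vals iota v (L ++ M)) nd' =
      node_val iota (fun i => (vals iota v L)`_(sigma i))
        (vals iota (fun i => (vals iota v L)`_(sigma i)) N) nd) ->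
  exists M f, [/\ nodes_wf (L ++ M), (nsize M <= nsize (rcons N nd))%N,
    (maxdepth (L ++ M) <= maxdepth L + maxdepth (rcons N nd))%N,
    (forall k, k < size (rcons N nd) ->
       f k < size (L ++ M) /\
       ndepth (L ++ M) (f k) <= maxdepth L + ndepth (rcons N nd) k)%N
    & forall k, (k < size (rcons N nd))%N ->
      forall (R : comNzRingType) (iota : {rmorphism F -> R}) v,
      (vals iota v (L ++ M))`_(f k) =
      (vals iota (fun i => (vals iota v L)`_(sigma i)) (rcons N nd))`_k].
  move=> wf' sz' d' val'; exists (rcons M nd'), (g (size (L ++ M))).
  rewrite -rcons_cat; split.
  - by rewrite nodes_wf_rcons wfM.
  - by rewrite !nsize_rcons sz' leq_add2r.
  - by rewrite !maxdepth_rcons; move: dM d'; lia.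
  - move=> k; rewrite size_rcons ltnS leq_eqVlt /g size_rcons.
    case: ltnP => [lt_k _|le_k].
      have [lt_fk d_k] := lt_f k lt_k.
      by rewrite !ndepth_rcons lt_k lt_fk ltnS ltnW.
    by rewrite orbF => /eqP->; rewrite !ndepth_rcons !ltnn !eqxx.
  move=> k; rewrite size_rcons ltnS leq_eqVlt /g => lt_k R iota v.
  move: lt_k; case: ltnP => [lt_k _|le_k].
    have [lt_fk _] := lt_f k lt_k.
    by rewrite !vals_rcons lt_k lt_fk val_f.
  by rewrite orbF => /eqP->; rewrite !vals_rcons !ltnn !eqxx val'.
case: nd wf_nd lt_sigma appended => [i|a|o us] wf_nd lt_sigma appended.
(* A variable adds no node: its copy is the node [sigma i] of [L]. *)
- have lt_i: (sigma i < size L)%N.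
    by apply: lt_sigma; rewrite has_var_rcons eqxx orbT.
  exists M, (g (sigma i)); split=> //.
  + by rewrite nsize_rcons (leq_trans szM) ?leq_addr.
  + by rewrite maxdepth_rcons /= maxn0.
  + move=> k; rewrite size_rcons ltnS leq_eqVlt /g ndepth_rcons.
    case: ltnP => [lt_k _|le_k]; first exact: lt_f.
    rewrite orbF => ->; split; first by rewrite size_cat ltn_addr.
    by rewrite ndepth_cat // addn0 ndepth_le_max.
  move=> k; rewrite size_rcons ltnS leq_eqVlt /g => lt_k R iota v.
  rewrite vals_rcons; move: lt_k; case: ltnP => [lt_k _|le_k].
    exact: val_f.
  by rewrite orbF => -> /=; rewrite vals_cat.
- by apply: (appended (Scal n a)).
case/andP: (wf_nd) => szus /allP ltus.
apply: (appended (Gate F n o (map f us))) => /=.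
- rewrite size_map szus; apply/allP => _ /mapP[u /ltus lt_u ->].
  by have [] := lt_f u lt_u.
- by rewrite size_map.
- rewrite addnS; apply: (gate_depth_le o) => _ /mapP[u u_us ->].
  have [_ /leq_trans->//] := lt_f u (ltus u u_us).
  by rewrite leq_add2l /ndepth (@leq_bigmax_seq _ _ predT (nth 0%N _)).
move=> R iota v.
by case: (o);
  rewrite big_map big_seq [RHS]big_seq; apply: eq_bigr => u /ltus lt_u;
  rewrite val_f.
Qed.

(** Each variable node of [N] contributes [x_i], [t_i] and their sum, of size 1 + 1 + 3 = 5. Running
    through the nodes of [N] rather than through all [m] variables keeps the size bounded in terms
    of [N]. *)
Lemma shifted_vars m (N : seq (node F m)) (x t : 'I_m -> 'I_n) :
  exists L (sx st : 'I_m -> nat), [/\ nodes_wf L, (nsize L <= 5 * size N)%N,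
    (maxdepth L <= 1)%N,
    (forall i, has_var i N -> sx i < size L /\ st i < size L)%N
    & forall i, has_var i N ->
      forall (R : comNzRingType) (iota : {rmorphism F -> R}) v,
      (vals iota v L)`_(sx i) = v (x i) /\
      (vals iota v L)`_(st i) = v (x i) + v (t i)].
Proof.
elim/last_ind: N => [|N nd [L [sx [st [wfL szL dL lt_s val_s]]]]].
  exists [::], (fun _ => 0%N), (fun _ => 0%N); split=> //.
    by rewrite /nsize big_nil.
  by rewrite /maxdepth /= big_nil.
have [[i def_nd]|nonvar] : (exists i, nd = Var F i) \/
    forall i, has_var i (rcons N nd) -> has_var i N.
  case: nd => [i|a|o us]; [by left; exists i| right=> i..];
    by rewrite has_var_rcons orbF.
  (* The new nodes [x_i], [t_i] and [x_i + t_i] take the positions [z], [z.+1] and [z.+2]; a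
     repeated variable just overrides its pointers. *)
  pose z := size L.
  exists (rcons (rcons (rcons L (Var F (x i))) (Var F (t i)))
           (Gate F n Plus [:: z; z.+1])).
  exists (fun j => if j == i then z else sx j).
  exists (fun j => if j == i then z.+2 else st j); split.
  - by rewrite !nodes_wf_rcons wfL /= !size_rcons !ltnS leqnSn leqnn.
  - by rewrite !nsize_rcons size_rcons /=; move: szL; lia.
  - rewrite !maxdepth_rcons !geq_max dL /= !(big_cons, big_nil).
    by rewrite -!/(ndepth _ _) !ndepth_rcons !size_rcons /z !(ltnn, eqxx, ltnSn).
  - move=> j; rewrite has_var_rcons def_nd eq_sym !size_rcons.
    case: eqP => _; first by rewrite orbT /z; lia.
    by rewrite orbF => /lt_s; lia.
  move=> j; rewrite has_var_rcons def_nd eq_sym => Nj R iota v.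
  rewrite !vals_rcons !size_rcons; move: Nj; case: eqP => [-> _|_].
    rewrite /z ltnn (gtn_eqF (ltnSn _)) ltnS leqnSn ltnSn ltnn eqxx.
    split=> //=.
    rewrite !(big_cons, big_nil) addr0 !vals_rcons !size_rcons.
    by rewrite !(ltnn, eqxx, ltnSn).
  rewrite orbF => Nj; have [lt1 lt2] := lt_s j Nj.
  rewrite !ltnS !(ltnW lt1, ltnW lt2, lt1, lt2) (leqW (ltnW lt1)).
  by rewrite (leqW (ltnW lt2)); apply: val_s.
exists L, sx, st; split=> //; try by move=> i /nonvar; auto.
by rewrite size_rcons; move: szL; lia.
Qed.

End Building.

(** * Lagrange interpolation over ['F_q] and the Frobenius map *)

Section Interpolation.
Variables (q : nat) (q_prime : prime q).

Lemma natr_Fq_inj : injective (fun j : 'I_q => j%:R : 'F_q).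
Proof.
move=> i j /(congr1 val); rewrite /= !val_Fp_nat // !modn_small //.
exact: val_inj.
Qed.

Lemma natr_Fq_surj (x : 'F_q) : exists j : 'I_q, x = j%:R.
Proof.
have lt_x : (x < q)%N by rewrite -[X in (_ < X)%N](Fp_cast q_prime).
by exists (Ordinal lt_x); rewrite natr_Zp.
Qed.

Definition ubit_coef (j : 'I_q) : 'F_q :=
  (\prod_(i < q | i != j) ((j%:R : 'F_q) - i%:R))^-1.

(** Stated over any algebra, so that the same unary bit can be evaluated at field elements and at
    polynomials. *)
Definition ubit_val (R : comNzRingType) (iota : 'F_q -> R) (j : 'I_q) (h : R) :=
  iota (ubit_coef j) * \prod_(i < q | i != j) (h - iota i%:R).

Lemma ubit_polyE n j (h : {mpoly 'F_q[n]}) :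
  ubit_poly j h = ubit_val (@mpolyC n 'F_q) j h.
Proof.
rewrite /ubit_val mul_mpolyC; congr (_ *: _).
by apply: eq_bigr => i _; rewrite rmorph_nat.
Qed.

(** The unary bits are the Lagrange basis: for [i = j] the coefficient cancels the product, and
    otherwise the factor of index [i] is zero. *)
Lemma ubit_val_nat (i j : 'I_q) :
  ubit_val (@idfun 'F_q) j i%:R = (i == j)%:R.
Proof.
rewrite /ubit_val /=; have [->|ne_ij] := eqVneq i j.
  rewrite mulVf //; apply/prodf_neq0 => k ne_kj.
  by rewrite subr_eq0 (inj_eq natr_Fq_inj) eq_sym.
by rewrite [X in _ * X](bigD1 i) //= subrr mul0r mulr0.
Qed.

Lemma ubit_val_eval (R : comNzRingType) (iota : {rmorphism 'F_q -> R}) j x :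
  ubit_val iota j (iota x) = iota (ubit_val idfun j x).
Proof.
rewrite /ubit_val rmorphM rmorph_prod; congr (_ * _).
by apply: eq_bigr => i _; rewrite rmorphB.
Qed.

Lemma ubit_val_unary j (x : 'F_q) : ubit_val idfun j x = (unary x j)%:R.
Proof.
have [i ->] := natr_Fq_surj x.
by rewrite ubit_val_nat /unary (inj_eq natr_Fq_inj) eq_sym.
Qed.

Section Algebra.
Variables (R : comNzRingType) (iota : {rmorphism 'F_q -> R}).

Lemma horner_map_XsubC (P : pred 'I_q) (h : R) :
  (map_poly iota (\prod_(i < q | P i) ('X - (i%:R : 'F_q)%:P))).[h] =
  \prod_(i < q | P i) (h - iota i%:R).
Proof.
rewrite rmorph_prod horner_prod; apply: eq_bigr => i _.
by rewrite rmorphB /= map_polyX map_polyC hornerXsubC.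
Qed.

(** Over ['F_q] this is the factorization of [X^q - X] into linear factors, reindexed by ['I_q] and
    then mapped into [R]. *)
Lemma prod_sub_Fq (h : R) : \prod_(i < q) (h - iota i%:R) = h ^+ q - h.
Proof.
rewrite -horner_map_XsubC.
have ->: \prod_(i < q) ('X - (i%:R : 'F_q)%:P) = 'X^q - 'X :> {poly 'F_q}.
  rewrite -[X in 'X^X](card_Fp q_prime) finField_genPoly.
  rewrite [RHS](reindex (fun j : 'I_q => j%:R : 'F_q)) //.
  apply: onW_bij; apply: inj_card_bij; first exact: natr_Fq_inj.
  by rewrite card_Fp ?card_ord.
by rewrite rmorphB /= map_polyXn map_polyX hornerD hornerN hornerXn hornerX.
Qed.

(** The factor [h - j] is the one missing from the product in the unary bit. *)
Lemma mul_ubit_val (j : 'I_q) (h : R) :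
  (h - iota j%:R) * ubit_val iota j h = iota (ubit_coef j) * (h ^+ q - h).
Proof. by rewrite mulrCA -prod_sub_Fq [in RHS](bigD1 j). Qed.

(** The sum minus 1, as a polynomial over ['F_q], has degree below [q] and vanishes at all [q] field
    elements, so it is zero. *)
Lemma sum_ubit_val (h : R) : \sum_j ubit_val iota j h = 1.
Proof.
pose p : {poly 'F_q} :=
  \sum_j (ubit_coef j)%:P * \prod_(i < q | i != j) ('X - (i%:R : 'F_q)%:P).
suff p1: p = 1.
  transitivity (map_poly iota p).[h]; last by rewrite p1 rmorph1 hornerC.
  rewrite rmorph_sum horner_sum; apply: eq_bigr => j _.
  by rewrite rmorphM hornerM horner_map_XsubC /= map_polyC hornerC.
apply/eqP; rewrite -subr_eq0; apply/eqP.
pose rs : seq 'F_q := [seq j%:R | j : 'I_q <- enum 'I_q].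
apply: (@roots_geq_poly_eq0 'F_q (p - 1) rs).
- apply/allP => _ /mapP[j _ ->]; rewrite /root hornerD hornerN hornerC subr_eq0.
  rewrite horner_sum (bigD1 j) //= [X in _ + X]big1 ?addr0 => [|k ne_kj];
    last first.
    rewrite hornerM horner_prod hornerC (bigD1 j) 1?eq_sym //=.
    by rewrite hornerXsubC subrr mul0r mulr0.
  have := ubit_val_nat j j; rewrite eqxx /ubit_val /= => Ej.
  rewrite -[X in _ == X]Ej.
  rewrite hornerM hornerC horner_prod; apply/eqP; congr (_ * _).
  by apply: eq_bigr => i _; rewrite hornerXsubC.
- by rewrite map_inj_uniq ?enum_uniq //; apply: natr_Fq_inj.
(* Each summand omits the factor of index [j], so its size is at most [q]. *)
rewrite size_map size_enum_ord (leq_trans (size_polyD _ _)) // size_polyN.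
rewrite size_poly1 geq_max prime_gt0 // andbT.
apply: (leq_trans (size_sum _ _ _)); apply/bigmax_leqP => j _.
rewrite mul_polyC (leq_trans (size_scale_leq _ _)) //.
rewrite -big_filter size_prod_XsubC size_filter.
have := count_predC (fun i => i != j) (index_enum 'I_q).
have : has (predC (fun i => i != j)) (index_enum 'I_q).
  by apply/hasP; exists j; rewrite ?mem_index_enum //= negbK.
have sz_q : size (index_enum 'I_q) = q by rewrite -[RHS](card_ord q) cardT enumT.
rewrite has_count => lt0 count_q.
by rewrite -[X in (_ <= X)%N]sz_q -count_q -addn1 leq_add2l.
Qed.

Lemma pchar_Fq_alg : q \in [pchar R].
Proof. exact: (rmorph_pchar iota (pchar_Fp q_prime)). Qed.

Lemma iota_Frobenius (a : 'F_q) : iota a ^+ q = iota a.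
Proof. by rewrite -rmorphXn -[X in a ^+ X](card_Fp q_prime) expf_card. Qed.

(** In characteristic [q] the power map is a ring morphism, and it fixes the constants from ['F_q];
    hence it passes through every gate. *)
Lemma vals_Frobenius n (v : 'I_n -> R) s k :
  (vals iota v s)`_k ^+ q = (vals iota (fun i => v i ^+ q) s)`_k.
Proof.
have := @rmorph_vals _ _ _ iota iota (pFrobenius_aut pchar_Fq_alg) n v s k.
by rewrite /= pFrobenius_autE; apply=> a; rewrite pFrobenius_autE iota_Frobenius.
Qed.

End Algebra.

Definition esub X (e1 e2 : expr 'F_q X) :=
  EGate Plus e1 (EGate Times (ECst (-1)) e2).

Definition eubit X (j : 'I_q) (e : expr 'F_q X) :=
  EGate Times (ECst (ubit_coef j))
    (eprod [seq i <- enum 'I_q | i != j] (fun i => esub e (ECst i%:R))).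

Lemma eval_sub X (R : comNzRingType) (iota : {rmorphism 'F_q -> R}) (v : X -> R)
    e1 e2 : eval iota v (esub e1 e2) = eval iota v e1 - eval iota v e2.
Proof. by rewrite /= rmorphN rmorph1 mulN1r. Qed.

Lemma eval_ubit X (R : comNzRingType) (iota : {rmorphism 'F_q -> R}) (v : X -> R)
    j e : eval iota v (eubit j e) = ubit_val iota j (eval iota v e).
Proof.
rewrite [LHS]/= eval_prod big_filter big_enum_cond; congr (_ * _).
by apply: eq_bigr => i _; rewrite eval_sub.
Qed.

(** * Deriving vanishing polynomials from the equations [h^q - h = 0] *)

Section Witness.
Variable X : finType.
Implicit Types (e : expr 'F_q X) (s : {ffun X -> 'I_q}).

Definition eval_at s e : 'F_q := eval idfun (fun x => (s x)%:R) e.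

(** The variable [(x, false)] stands for [h_x] and [(x, true)] for its [q]-th power. The expression
    computes [(e - e(s)) U_s]. At a variable this is the identity [mul_ubit_val] times the remaining
    bits of [U_s]; at a product it follows [a b - a(s) b(s) = a (b - b(s)) + b(s) (a - a(s))]. *)
Fixpoint witness_at s e : expr 'F_q (X * bool) :=
  match e with
  | EVar x =>
      EGate Times
        (EGate Times (ECst (ubit_coef (s x)))
          (esub (EVar (x, true)) (EVar (x, false))))
        (eprod [seq y <- enum X | y != x]
          (fun y => eubit (s y) (EVar (y, false))))
  | ECst _ => ECst 0
  | EGate Plus e1 e2 => EGate Plus (witness_at s e1) (witness_at s e2)
  | EGate Times e1 e2 =>
      EGate Plus
        (EGate Times (erename (fun x => (x, false)) e1) (witness_at s e2))
        (EGate Times (ECst (eval_at s e2)) (witness_at s e1))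
  end.

Definition witness e : expr 'F_q (X * bool) :=
  esum (enum {ffun X -> 'I_q}) (fun s => witness_at s e).

Section Eval.
Variables (R : comNzRingType) (iota : {rmorphism 'F_q -> R}).
Variable v : X * bool -> R.

(** Every variable leaf carries the factor [(x, true) - (x, false)], and the recursion is linear in
    the leaves. *)
Lemma witness_diag e :
  (forall x, v (x, true) = v (x, false)) -> eval iota v (witness e) = 0.
Proof.
move=> diag; rewrite eval_sum big1_seq // => s _.
elim: e => [x|a|[] e1 IH1 e2 IH2]; last 1 first.
- by rewrite [LHS]/= IH1 IH2 !mulr0 addr0.
(* Only the two outer products are exposed, which leaves [esub] folded for [eval_sub]. *)
- have -> // : forall a b c : expr 'F_q (X * bool),
      eval iota v (EGate Times (EGate Times a b) c) =
      eval iota v a * eval iota v b * eval iota v c by [].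
  by rewrite eval_sub /= diag subrr mulr0 mul0r.
- by rewrite /= rmorph0.
by rewrite [LHS]/= IH1 IH2 addr0.
Qed.

Lemma witness_at_Frobenius s e :
  (forall x, v (x, true) = v (x, false) ^+ q) ->
  eval iota v (witness_at s e) =
  (eval iota (fun x => v (x, false)) e - iota (eval_at s e)) *
    \prod_x ubit_val iota (s x) (v (x, false)).
Proof.
move=> frob; elim: e => [x|a|[] e1 IH1 e2 IH2].
- have -> // : forall a b c : expr 'F_q (X * bool),
      eval iota v (EGate Times (EGate Times a b) c) =
      eval iota v a * eval iota v b * eval iota v c by [].
  rewrite eval_sub /= frob -mul_ubit_val eval_prod big_filter big_enum_cond /=.
  rewrite [in RHS](bigD1 x) //= [RHS]mulrA; congr (_ * _).
  by apply: eq_bigr => y _; rewrite -[LHS]/(eval iota v (eubit _ _)) eval_ubit.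
- by rewrite /= rmorph0 subrr mul0r.
- rewrite [LHS]/= IH1 IH2 /eval_at /= rmorphD.
  by ring.
rewrite [LHS]/= IH1 IH2 eval_rename /eval_at /= rmorphM.
by rewrite -[eval iota (v \o _) e1]/(eval iota (fun x => v (x, false)) e1); ring.
Qed.

(** Since [e] vanishes at each [s], the summands are [e U_s], and the [U_s] sum to 1. *)
Lemma witness_Frobenius e :
  (forall s, eval_at s e = 0) -> (forall x, v (x, true) = v (x, false) ^+ q) ->
  eval iota v (witness e) = eval iota (fun x => v (x, false)) e.
Proof.
move=> vanish frob; rewrite eval_sum big_enum /=.
under eq_bigr do rewrite witness_at_Frobenius // vanish rmorph0 subr0.
rewrite -big_distrr /=.
(* The sum over points of products of bits is the product over [x] of the sums of the bits of
   [h_x]. *)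
rewrite -(bigA_distr_bigA (fun x j => ubit_val iota j (v (x, false)))).
by rewrite big1 ?mulr1 // => x _; apply: sum_ubit_val.
Qed.

End Eval.
End Witness.
End Interpolation.

(** * Polynomials of nodes, and substitution as evaluation *)

Section NodePolynomials.
Variables (F : fieldType) (n : nat).

Definition nodepoly (s : seq (node F n)) (k : nat) : {mpoly F[n]} :=
  (vals (@mpolyC n F) (fun i => 'X_i) s)`_k.

Lemma cpolyE (C : circuit F n) : cpoly C = nodepoly (nodes C) (out C).
Proof. by []. Qed.

(** The inputs of a gate precede it, so their values in the prefix are already their values in the
    whole sequence. *)
Lemma nodepoly_node s k : nodes_wf s -> (k < size s)%N ->
  nodepoly s k =
  node_poly (vals (@mpolyC n F) (fun i => 'X_i) s) (nth (Scal n 0) s k).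
Proof.
elim/last_ind: s => // s nd IHs; rewrite nodes_wf_rcons => /andP[wfs wf_nd].
have stable us : all (fun u => u < size s)%N us ->
    (forall u, u \in us ->
      (vals (@mpolyC n F) (fun i => 'X_i) (rcons s nd))`_u = nodepoly s u).
  by move=> /allP lt_us u /lt_us lt_u; rewrite vals_rcons lt_u.
have stable_nd nd' : node_wf (size s) nd' ->
    node_poly (vals (@mpolyC n F) (fun i => 'X_i) s) nd' =
    node_poly (vals (@mpolyC n F) (fun i => 'X_i) (rcons s nd)) nd'.
  case: nd' => // o us /andP[_ /stable eq_us].
  by case: o => /=; rewrite big_seq [RHS]big_seq; apply: eq_bigr => u /eq_us->.
rewrite size_rcons ltnS leq_eqVlt /nodepoly vals_rcons nth_rcons.
case: ltnP => [lt_k _|_]; last by rewrite orbF => ->; apply: stable_nd.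
rewrite -/(nodepoly s k) IHs // stable_nd //.
have /allP/(_ k) := wfs; rewrite mem_iota lt_k => /(_ isT).
case: (nth _ s k) => // o us /andP[sz_us /allP lt_us] /=; rewrite sz_us /=.
by apply/allP => u /lt_us/ltn_trans->.
Qed.

End NodePolynomials.

Section Substitution.
Variables (F : fieldType) (n : nat).

(** Composition with [ts] is a ring morphism fixing the constants, so it can be carried out node by
    node. *)
Lemma comp_cpoly m (D : circuit F m) (ts : m.-tuple {mpoly F[n]}) :
  cpoly D \mPo ts = (vals (@mpolyC n F) (tnth ts) (nodes D))`_(out D).
Proof.
rewrite cpolyE /nodepoly.
rewrite (@rmorph_vals _ _ _ (@mpolyC m F) (@mpolyC n F) (comp_mpoly ts)).
  by apply: vals_ext => i _ /=; rewrite comp_mpolyXU -tnth_nth.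
by move=> a; apply: comp_mpolyC.
Qed.

Lemma ips_subst_lshift m (ts : 'I_m -> {mpoly F[n]}) i :
  tnth (ips_subst ts) (lshift m i) = 'X_i.
Proof. by rewrite tnth_mktuple (unsplitK (inl i)). Qed.

Lemma ips_subst_rshift m (ts : 'I_m -> {mpoly F[n]}) j :
  tnth (ips_subst ts) (rshift n j) = ts j.
Proof. by rewrite tnth_mktuple (unsplitK (inr j)). Qed.

End Substitution.

(** * IPS proofs of linear size and of depth linear in that of the circuit *)

Section Derivations.
Variables (q : nat) (q_prime : prime q) (n : nat) (C : circuit 'F_q n).
Hypothesis C_wf : circuit_wf C.

Let C_nodes_wf : nodes_wf (nodes C).
Proof. by case/andP: C_wf. Qed.

Let csize_gt0 : (0 < csize C)%N.
Proof.
apply: leq_trans (size_le_nsize (nodes C)).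
by case/andP: C_wf => lt_out _; apply: leq_ltn_trans lt_out.
Qed.

(** The successor in the depth bound leaves room for constant depth when [C] has depth 0. *)
Definition derivable (c : nat) (p : {mpoly 'F_q[n]}) :=
  exists D : circuit 'F_q (n + size (circuit_axioms C)),
    [/\ circuit_wf D,
        ips_alg_proof (circuit_axioms C) p D,
        (csize D <= c * csize C)%N
      & (cdepth D <= c * (cdepth C).+1)%N].

Lemma derivable_leq c c' p : (c <= c')%N -> derivable c p -> derivable c' p.
Proof.
move=> le_c [D [wfD proofD szD dD]]; exists D; split=> //.
  by rewrite (leq_trans szD) // leq_mul2r le_c orbT.
by rewrite (leq_trans dD) // leq_mul2r le_c orbT.
Qed.

(** Covers [C] itself and [C] with one gate added for an auxiliary node, which is not a node of
    [C]. *)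
Definition small_extension (N : seq (node 'F_q n)) :=
  [/\ nodes_wf N, forall i, has_var i N -> i \in vars C,
      (nsize N <= 2 * csize C)%N & (maxdepth N <= (cdepth C).+1)%N].

Lemma mem_vars i : (i \in vars C) = has_var i (nodes C).
Proof. by rewrite mem_filter mem_enum andbT. Qed.

Lemma size_circuit_axioms : size (circuit_axioms C) = (size (vars C)).+1.
Proof. by rewrite size_rcons size_map. Qed.

Lemma axiom_var i : i \in vars C ->
  (circuit_axioms C)`_(index i (vars C)) = 'X_i ^+ q - 'X_i.
Proof.
move=> Ci; rewrite nth_rcons size_map index_mem Ci.
by rewrite (nth_map i) ?index_mem // nth_index.
Qed.

Lemma axiom_out : (circuit_axioms C)`_(size (vars C)) = cpoly C.
Proof. by rewrite nth_rcons size_map ltnn eqxx. Qed.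

(* 14 = (5 + 1 + 1) * 2: at most 5 units of size per node of [N] for the variables
   [x_i] and [x_i + t_i], and one copy of [N] on each; [N] has size at most twice
   that of [C]. *)
Lemma derivable_vanishing (X : finType) (e : expr 'F_q X) N (a : X -> nat) :
  (forall s, eval_at s e = 0) -> small_extension N ->
  (forall x, a x < size N)%N ->
  derivable (14 + esize (witness e))
    (eval (@mpolyC n 'F_q) (fun x => nodepoly N (a x)) e).
Proof.
move=> vanish [wfN varsN szN dN] lt_a.
have lt_t i : (index i (vars C) < size (circuit_axioms C))%N.
  by rewrite size_circuit_axioms ltnS index_size.
(* For [i] outside [vars C] the index is that of the axiom [C = 0]. This is harmless, as the
   variables of [N] all lie in [vars C]. *)
pose t i := rshift n (Ordinal (lt_t i)).
have [L [sx [st [wfL szL dL lt_s val_s]]]] :=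
  shifted_vars N (lshift (size (circuit_axioms C))) t.
have [|M1 [f1 [wf1 sz1 d1 lt1 val1]]] := @append_subst _ _ _ N L sx wfL wfN.
  by move=> i /lt_s[].
have [|M2 [f2 [wf2 sz2 d2 lt2 val2]]] :=
  @append_subst _ _ _ N (L ++ M1) st wf1 wfN.
  by move=> i /lt_s[_ lt_i]; rewrite size_cat ltn_addr.
(* The copy labelled [false] computes [h(x)], the one labelled [true] computes [h(x + t)]. *)
pose p (xb : X * bool) := (if xb.2 then f2 else f1) (a xb.1).
have lt_p xb : (p xb < size ((L ++ M1) ++ M2))%N.
  case: xb => x []; rewrite /p /=; first by case: (lt2 _ (lt_a x)).
  by rewrite size_cat ltn_addr //; case: (lt1 _ (lt_a x)).
have [M3 [k [wf3 lt_k sz3 d3 val3]]] := append_expr (witness e) wf2 lt_p.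
pose D := Circuit (((L ++ M1) ++ M2) ++ M3) k.
have val_copy (v : 'I_(n + size (circuit_axioms C)) -> {mpoly 'F_q[n]}) x :
    (forall i, v (lshift _ i) = 'X_i) ->
    (vals (@mpolyC n 'F_q) v ((L ++ M1) ++ M2))`_(p (x, false)) = nodepoly N (a x).
  move=> vX; rewrite vals_cat; last by case: (lt1 _ (lt_a x)).
  rewrite val1 //; apply: vals_ext => i /val_s.
  by case/(_ _ (@mpolyC n 'F_q) v) => -> _; rewrite vX.
have val_shift (v : 'I_(n + size (circuit_axioms C)) -> {mpoly 'F_q[n]}) w x :
    (forall i, i \in vars C -> v (lshift _ i) + v (t i) = w i) ->
    (vals (@mpolyC n 'F_q) v ((L ++ M1) ++ M2))`_(p (x, true)) =
    (vals (@mpolyC n 'F_q) w N)`_(a x).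
  move=> vw; rewrite val2 //; apply: vals_ext => i Ni.
  rewrite vals_cat; last by case: (lt_s i Ni).
  by have [_ ->] := val_s i Ni _ (@mpolyC n 'F_q) v; rewrite vw ?varsN.
exists D; split.
- by rewrite /circuit_wf lt_k; apply: wf3.
(* With [t = 0] the two copies agree; with [t_i = x_i^q - x_i] the second one computes
   [h(x^q) = h(x)^q]. *)
- split; rewrite comp_cpoly /= val3.
    apply: witness_diag => x; rewrite val_copy => [|i]; last first.
      exact: ips_subst_lshift.
    apply: val_shift => i _.
    by rewrite ips_subst_lshift ips_subst_rshift addr0.
  rewrite witness_Frobenius // => [|x].
    by apply: eval_ext => x; rewrite val_copy // => i; apply: ips_subst_lshift.
  rewrite val_copy => [|i]; last exact: ips_subst_lshift.
  rewrite /nodepoly vals_Frobenius //; apply: val_shift => i Ci.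
  by rewrite ips_subst_lshift ips_subst_rshift axiom_var // addrC subrK.
- rewrite -[csize D]/(nsize _) !nsize_cat.
  have := size_le_nsize N; move: csize_gt0 szN szL sz1 sz2 sz3.
  move: (nsize _) (csize C) (nsize M1) (nsize M2) (nsize M3) => sN sC s1 s2 s3.
  move: (size N) (nsize L) (esize _) => s4 s5 s6.
  by nia.
rewrite -[cdepth D]/(maxdepth _).
(* The two copies are counted as if stacked, which at most doubles the contribution of [N] to the
   depth. *)
have d2' := leq_trans d2 (leq_add d1 (leqnn _)).
apply: (leq_trans d3); move: dL d2' dN.
move: (maxdepth (_ ++ _)) (maxdepth L) (maxdepth N) (cdepth C) => x1 x2 x3 x4.
by move: (esize _) => x5; nia.
Qed.

(** The proof is [e] applied to the placeholder of the axiom [C = 0]: at 0 it vanishes, and at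
    [cpoly C] it is the required polynomial. *)
Lemma derivable_out (e : expr 'F_q unit) :
  eval idfun (fun _ => 0) e = 0 ->
  derivable (14 + esize e) (eval (@mpolyC n 'F_q) (fun _ => cpoly C) e).
Proof.
move=> e0.
have lt_t : (size (vars C) < size (circuit_axioms C))%N.
  by rewrite size_circuit_axioms.
pose t := rshift n (Ordinal lt_t).
have wfL : nodes_wf [:: Var 'F_q t] by [].
have [M [k [wfM lt_k szM dM valM]]] :=
  @append_expr _ _ _ e [:: Var 'F_q t] (fun _ => 0%N) wfL (fun _ => isT).
exists (Circuit ([:: Var 'F_q t] ++ M) k); split.
- by rewrite /circuit_wf lt_k; apply: wfM.
- split; rewrite comp_cpoly valM.
    rewrite -[RHS](rmorph0 (@mpolyC n 'F_q)) -e0.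
    rewrite (@rmorph_eval _ _ _ _ _ (@mpolyC n 'F_q)) //.
    by apply: eval_ext => x /=; rewrite ips_subst_rshift rmorph0.
  by apply: eval_ext => x /=; rewrite ips_subst_rshift axiom_out.
- rewrite -[csize _]/(nsize _) nsize_cat.
  have -> : nsize [:: Var 'F_q t] = 1%N by rewrite /nsize big_seq1.
  move: csize_gt0 szM; move: (nsize M) (csize C) (esize e) => x1 x2 x3; nia.
rewrite -[cdepth _]/(maxdepth _).
move: dM; have ->: maxdepth [:: Var 'F_q t] = 0%N by rewrite /maxdepth big_seq1.
by move: (maxdepth _) (cdepth C) (esize e) => x1 x2 x3; nia.
Qed.

End Derivations.

(** * Decidable equality of the nodes carrying bits, for membership in [bnodes] *)

Definition bnode_code n (u : bnode n) : 'I_n + (nat + nat * nat) :=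
  match u with
  | BVar i => inl i
  | BGate g => inr (inl g)
  | BAux g i => inr (inr (g, i))
  end.

Definition bnode_decode n (x : 'I_n + (nat + nat * nat)) : bnode n :=
  match x with
  | inl i => BVar i
  | inr (inl g) => BGate n g
  | inr (inr gi) => BAux n gi.1 gi.2
  end.

Lemma bnode_codeK n : cancel (@bnode_code n) (@bnode_decode n).
Proof. by case. Qed.

HB.instance Definition _ n := Equality.copy (bnode n) (can_type (@bnode_codeK n)).

(** * The equations of the encoding as expressions in one or two node values *)

Section Equations.
Variables (q : nat) (q_prime : prime q).

Definition eq_total : expr 'F_q unit :=
  EGate Times
    (eprod (enum 'I_q) (fun j => esub (ECst 1) (eubit j (EVar tt))))
    (ECst 1).

Definition eq_pair (j l : 'I_q) : expr 'F_q unit :=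
  EGate Times (eubit j (EVar tt)) (eubit l (EVar tt)).

Definition eq_boolean (j : 'I_q) : expr 'F_q unit :=
  esub (EGate Times (eubit j (EVar tt)) (eubit j (EVar tt))) (eubit j (EVar tt)).

Definition eq_out (j : 'I_q) : expr 'F_q unit :=
  esub (eubit j (EVar tt)) (ECst (j == 0%N :> nat)%:R).

(** After substitution the third node of an equation has the value of the operation on the other
    two, so two variables suffice. *)
Definition operand (o : gate_op) : 'I_3 -> expr 'F_q bool :=
  triple (EVar false) (EVar true) (EGate o (EVar false) (EVar true)).

Definition eq_clause (o : gate_op) (cl : clause3 q) : expr 'F_q bool :=
  EGate Times
    (eprod (enum cl.1) (fun v => esub (ECst 1) (eubit v.2 (operand o v.1))))
    (eprod (enum cl.2) (fun v => eubit v.2 (operand o v.1))).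

Lemma eval_total (R : comNzRingType) (iota : {rmorphism 'F_q -> R}) v :
  eval iota v eq_total = \prod_j (1 - ubit_val iota j (v tt)).
Proof.
rewrite [LHS]/= rmorph1 mulr1 eval_prod big_enum; apply: eq_bigr => j _.
by rewrite eval_sub eval_ubit /= rmorph1.
Qed.

Lemma eval_pair (R : comNzRingType) (iota : {rmorphism 'F_q -> R}) v j l :
  eval iota v (eq_pair j l) = ubit_val iota j (v tt) * ubit_val iota l (v tt).
Proof.
by rewrite -[LHS]/(eval iota v (eubit j _) * eval iota v (eubit l _)) !eval_ubit.
Qed.

Lemma eval_boolean (R : comNzRingType) (iota : {rmorphism 'F_q -> R}) v j :
  eval iota v (eq_boolean j) =
  ubit_val iota j (v tt) ^+ 2 - ubit_val iota j (v tt).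
Proof. by rewrite eval_sub eval_pair eval_ubit expr2. Qed.

Lemma eval_out (R : comNzRingType) (iota : {rmorphism 'F_q -> R}) v j :
  eval iota v (eq_out j) = ubit_val iota j (v tt) - (j == 0%N :> nat)%:R.
Proof. by rewrite eval_sub eval_ubit /= rmorph_nat. Qed.

Lemma eval_clause (R : comNzRingType) (iota : {rmorphism 'F_q -> R}) v o cl :
  eval iota v (eq_clause o cl) =
  \prod_(w <- enum cl.1) (1 - ubit_val iota w.2 (eval iota v (operand o w.1))) *
  \prod_(w <- enum cl.2) ubit_val iota w.2 (eval iota v (operand o w.1)).
Proof.
rewrite [LHS]/= !eval_prod; congr (_ * _); apply: eq_bigr => w _.
  by rewrite eval_sub eval_ubit /= rmorph1.
by rewrite eval_ubit.
Qed.

Lemma vanish_total s : eval_at s eq_total = 0.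
Proof.
rewrite /eval_at eval_total (bigD1 (s tt)) //= ubit_val_nat // eqxx.
by rewrite subrr mul0r.
Qed.

Lemma vanish_pair j l s : j != l -> eval_at s (eq_pair j l) = 0.
Proof.
move=> ne_jl; rewrite /eval_at eval_pair !ubit_val_nat // -natrM mulnb.
by case: eqP => // ->; rewrite (negPf ne_jl).
Qed.

Lemma vanish_boolean j s : eval_at s (eq_boolean j) = 0.
Proof.
rewrite /eval_at eval_boolean ubit_val_nat //.
by case: eqP => _; rewrite ?expr1n ?expr0n subrr.
Qed.

Lemma vanish_out j : eval idfun (fun _ => 0) (eq_out j) = 0 :> 'F_q.
Proof.
rewrite eval_out ubit_val_unary // /unary.
have -> : (j%:R == 0 :> 'F_q) = (j == 0%N :> nat).
  by rewrite -val_eqE /= val_Fp_nat // modn_small.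
exact: subrr.
Qed.

(** At a point of [F_q^2] the bits are the unary codes of [x], [y] and [x o y], which satisfy [T]. A
    true literal of the clause gives a zero factor. *)
Lemma vanish_clause o (T : cnf3 q) cl s :
  truth_table_cnf o T -> cl \in T -> eval_at s (eq_clause o cl) = 0.
Proof.
case=> sat_T _ T_cl; rewrite /eval_at eval_clause.
pose x : 'F_q := (s false)%:R; pose y : 'F_q := (s true)%:R.
pose v b : 'F_q := (s b)%:R.
have bitE (r : 'I_3) j : ubit_val idfun j (eval idfun v (operand o r)) =
    (triple (unary x) (unary y) (unary (op_fun o x y)) r j)%:R.
  rewrite ubit_val_unary //; case: r => [[|[|[|//]]] lt_r] //.
have : sat3 (triple (unary x) (unary y) (unary (op_fun o x y))) T.
  by apply/sat_T.
move/forall_inP/(_ cl T_cl)/orP=> [] /exists_inP[w cl_w].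
  move=> w1; rewrite (bigD1_seq w) ?mem_enum ?enum_uniq //= bitE w1.
  by rewrite subrr !mul0r.
move/negPf=> w0; rewrite [X in _ * X](bigD1_seq w) ?mem_enum ?enum_uniq //=.
by rewrite bitE w0 mul0r mulr0.
Qed.

(** The maxima range over all clauses in the bits of three nodes, so the bound is independent of the
    choice of the CNFs as well as of the circuit. *)
Definition witness_bound : nat :=
  maxn (maxn (esize (witness eq_total))
             (\max_(jl : 'I_q * 'I_q) esize (witness (eq_pair jl.1 jl.2))))
  (maxn (maxn (\max_j esize (witness (eq_boolean j))) (\max_j esize (eq_out j)))
        (maxn (\max_(cl : clause3 q) esize (witness (eq_clause Plus cl)))
              (\max_(cl : clause3 q) esize (witness (eq_clause Times cl))))).

(** * Substituted bits as unary bits of node polynomials *)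

Variables (n : nat) (C : circuit 'F_q n).
Hypothesis C_wf : circuit_wf C.

Let C_nodes_wf : nodes_wf (nodes C).
Proof. by case/andP: C_wf. Qed.

Lemma node_bitsE k j : (k < size (nodes C))%N ->
  subst_ubit C (node_bits C k j) =
  ubit_val (@mpolyC n 'F_q) j (nodepoly (nodes C) k).
Proof.
move=> lt_k; rewrite /node_bits; case def_k: (node_at C k) => [i|a|o us].
- by rewrite nodepoly_node // -/(node_at C k) def_k [LHS]ubit_polyE.
- rewrite nodepoly_node // -/(node_at C k) def_k [node_poly _ _]/=.
  by rewrite ubit_val_eval ubit_val_unary // rmorph_nat.
by rewrite [LHS]ubit_polyE.
Qed.

Lemma gate_in_range g o us : node_at C g = Gate _ _ o us ->
  [/\ (g < size (nodes C))%N, (1 < size us)%N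
    & forall u, u \in us -> (u < size (nodes C))%N].
Proof.
(* Positions beyond the end read as the default scalar, hence not as a gate. *)
move=> def_g; have lt_g: (g < size (nodes C))%N.
  by rewrite ltnNge; apply/negP => le_g; rewrite /node_at nth_default in def_g.
have /allP/(_ g) := C_nodes_wf; rewrite mem_iota lt_g => /(_ isT).
rewrite -/(node_at C g) def_g => /andP[sz_us /allP lt_us]; split=> // u /lt_us.
by move/ltn_trans; apply.
Qed.

Lemma gate_size g o us : node_at C g = Gate _ _ o us ->
  ((size us).+1 <= csize C)%N.
Proof.
move=> def_g; have [lt_g _ _] := gate_in_range def_g.
rewrite /csize (big_nth (Scal n 0)) big_mkord (bigD1 (Ordinal lt_g)) //=.
by rewrite -/(node_at C g) def_g leq_addr.
Qed.

Lemma small_extension_nodes : small_extension C (nodes C).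
Proof.
split=> // [i|]; first by rewrite mem_vars.
by rewrite mul2n -addnn leq_addr.
Qed.

Definition aux_nodes o us i := rcons (nodes C) (Gate 'F_q n o (take i.+1 us)).

(** The added gate has [i.+1] wires, at least two because [i] is positive, and costs no more than
    gate [g]. *)
Lemma small_extension_aux g o us i :
  node_at C g = Gate _ _ o us -> (0 < i)%N -> (i < size us)%N ->
  small_extension C (aux_nodes o us i).
Proof.
move=> def_g i_gt0 lt_i; have [lt_g sz_us lt_us] := gate_in_range def_g.
have sz_take : size (take i.+1 us) = i.+1 by rewrite size_takel.
split.
- rewrite nodes_wf_rcons C_nodes_wf /= sz_take ltnS i_gt0.
  by apply/allP => u /mem_take/lt_us.
- by move=> k; rewrite mem_vars has_var_rcons orbF.
- rewrite nsize_rcons mul2n -addnn leq_add2l (leq_trans _ (gate_size def_g)) //=.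
  by rewrite sz_take.
exact: maxdepth_rcons_le.
Qed.

Lemma nodepoly_aux_node o us i k : (k < size (nodes C))%N ->
  nodepoly (aux_nodes o us i) k = nodepoly (nodes C) k.
Proof. by move=> lt_k; rewrite /nodepoly vals_rcons lt_k. Qed.

Definition op_poly o us : {mpoly 'F_q[n]} :=
  match o with
  | Plus => \sum_(u <- us) nodepoly (nodes C) u
  | Times => \prod_(u <- us) nodepoly (nodes C) u
  end.

Lemma op_polyE o us :
  op_poly o us =
  node_poly (vals (@mpolyC n 'F_q) (fun i => 'X_i) (nodes C)) (Gate 'F_q n o us).
Proof. by case: o. Qed.

Lemma nodepoly_aux o us i :
  nodepoly (aux_nodes o us i) (size (nodes C)) = op_poly o (take i.+1 us).
Proof. by rewrite op_polyE /nodepoly vals_rcons ltnn eqxx. Qed.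

(** The new input is put in front of the accumulated prefix, the order of the operands in the binary
    equations. *)
Lemma op_poly_take o us i : (i < size us)%N ->
  op_poly o (take i.+1 us) =
  op_fun o (nodepoly (nodes C) (nth 0%N us i)) (op_poly o (take i us)).
Proof.
move=> lt_i; rewrite (take_nth 0%N) //.
by case: o; rewrite /op_poly big_rcons; [apply: addrC | apply: mulrC].
Qed.

Lemma op_poly_two o us : (1 < size us)%N ->
  op_poly o (take 2 us) =
  op_fun o (nodepoly (nodes C) (nth 0%N us 0))
           (nodepoly (nodes C) (nth 0%N us 1)).
Proof.
case: us => [|u0 [|u1 us]] // _; rewrite /op_poly /= take0.
by case: o; rewrite !(big_cons, big_nil) ?addr0 ?mulr1.
Qed.

Lemma bnode_aux g o us i : node_at C g = Gate _ _ o us ->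
  cpoly (bnode_circuit C (BAux n g i)) = op_poly o (take i.+1 us).
Proof. by move=> def_g; rewrite /= def_g cpolyE /= nodepoly_aux. Qed.

Lemma bnode_gate g o us : node_at C g = Gate _ _ o us ->
  cpoly (bnode_circuit C (BGate n g)) = op_poly o us.
Proof.
move=> def_g; have [lt_g _ _] := gate_in_range def_g.
by rewrite cpolyE nodepoly_node //= -/(node_at C g) def_g op_polyE.
Qed.

Lemma binary_bitsE g o us i : node_at C g = Gate _ _ o us ->
  (i < (size us).-1)%N ->
  exists N (a : bool -> nat), [/\ small_extension C N,
    forall b, (a b < size N)%N
    & forall r j, subst_ubit C (binary_bits C g us i r j) =
        ubit_val (@mpolyC n 'F_q) j
          (eval (@mpolyC n 'F_q) (fun b => nodepoly N (a b)) (operand o r))].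
Proof.
move=> def_g lt_i; have [lt_g sz_us lt_us] := gate_in_range def_g.
have lt_i1 : (i.+1 < size us)%N by rewrite -ltn_predRL.
have lt_nth k : (k < size us)%N -> (nth 0%N us k < size (nodes C))%N.
  by move=> lt_k; apply/lt_us/mem_nth.
(* In the last equation the prefix is all of [us] and the result is [g] itself. *)
have bit_out j :
    subst_ubit C ((if i.+1 == (size us).-1 then Bit (BGate n g)
                   else Bit (BAux n g i.+1)) j) =
    ubit_val (@mpolyC n 'F_q) j (op_poly o (take i.+2 us)).
  case: eqP => [last_i|_]; rewrite [LHS]ubit_polyE.
    rewrite (bnode_gate def_g) take_oversize //.
    by rewrite last_i (ltn_predK sz_us).
  by rewrite (bnode_aux _ def_g).
(* The first equation reads two nodes of [C]; each later one reads an auxiliary node, provided by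
   one added gate. *)
have [i0|i_gt0] := posnP i.
  (* The boolean label is coerced to the position 0 or 1 in [us]. *)
  exists (nodes C), (fun b : bool => nth 0%N us b); split.
  - exact: small_extension_nodes.
  - by case; apply: lt_nth => //; apply: ltnW.
  rewrite /binary_bits i0 in bit_out *.
  case=> [[|[|[|r]]] lt_r] j; last by case: (notF lt_r).
  - exact: (node_bitsE j (lt_nth 0%N (ltnW sz_us))).
  - exact: (node_bitsE j (lt_nth 1%N sz_us)).
  by apply: (etrans (bit_out j)); congr ubit_val; apply: op_poly_two.
exists (aux_nodes o us i).
exists (fun b => if b then size (nodes C) else nth 0%N us i.+1); split.
- by apply: (small_extension_aux def_g) => //; apply: ltnW.
- by case; rewrite size_rcons // ltnW // ltnS lt_nth.
rewrite /binary_bits (gtn_eqF i_gt0).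
case=> [[|[|[|r]]] lt_r] j; last by case: (notF lt_r).
- apply: (etrans (node_bitsE j (lt_nth _ lt_i1))); congr ubit_val.
  by apply/esym/nodepoly_aux_node/lt_nth.
- apply: (etrans (ubit_polyE _ _)); congr ubit_val.
  by rewrite (bnode_aux _ def_g); apply/esym/nodepoly_aux.
apply: (etrans (bit_out j)); congr ubit_val; rewrite (op_poly_take _ lt_i1).
by congr op_fun; apply/esym;
  [apply/nodepoly_aux_node/lt_nth | apply: nodepoly_aux].
Qed.

Lemma var_node i : i \in vars C ->
  exists2 k, (k < size (nodes C))%N & nodepoly (nodes C) k = 'X_i.
Proof.
rewrite mem_vars => /(has_nthP (Scal n 0))[k lt_k def_k]; exists k => //.
by rewrite nodepoly_node //; case: (nth _ _ k) def_k => // _ /eqP->.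
Qed.

Lemma bnode_nodepoly u : u \in bnodes C ->
  exists N k, [/\ small_extension C N, (k < size N)%N
    & cpoly (bnode_circuit C u) = nodepoly N k].
Proof.
rewrite mem_cat => /orP[/mapP[i /var_node[k lt_k def_k] ->]|].
  by exists (nodes C), k; split=> //; apply: small_extension_nodes.
case/flatten_mapP=> g _; case def_g: (node_at C g) => [//|//|o us].
have [lt_g sz_us _] := gate_in_range def_g.
rewrite inE => /predU1P[->|/mapP[i + ->]].
  by exists (nodes C), g; split=> //; apply: small_extension_nodes.
rewrite mem_iota => /andP[i_gt0 lt_i].
exists (aux_nodes o us i), (size (nodes C)); split.
- by apply: (small_extension_aux def_g) => //; lia.
- by rewrite size_rcons.
by rewrite (bnode_aux _ def_g) nodepoly_aux.
Qed.

(** Four families are treated in turn: clauses of variables, clauses of gates, Boolean axioms and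
    output equations. The first three vanish on all field values; the last uses the axiom
    [C = 0]. *)
Lemma scnf_derivable (T : gate_op -> cnf3 q) p :
  (forall o, truth_table_cnf o (T o)) -> p \in scnf C T ->
  derivable C (14 + witness_bound) p.
Proof.
move=> T_ok; rewrite /scnf /cnf !map_cat !mem_cat => /or4P[].
- rewrite map_flatten -map_comp => /flatten_mapP[i /var_node[k lt_k def_k]].
  have total_or_pair e : (forall s, eval_at s e = 0) ->
      (esize (witness e) <= witness_bound)%N ->
      derivable C (14 + witness_bound)
        (eval (@mpolyC n 'F_q) (fun _ : unit => 'X_i) e).
    move=> vanish le_e; apply: (@derivable_leq _ _ _ (14 + esize (witness e))).
      by rewrite leq_add2l.
    rewrite -def_k; apply: (derivable_vanishing q_prime C_wf) => //.
    exact: small_extension_nodes.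
  rewrite inE => /predU1P[->|].
    rewrite /= big_nil mulr1 big_map big_enum /=.
    under eq_bigr do rewrite ubit_polyE.
    rewrite -(eval_total (@mpolyC n 'F_q) (fun _ => 'X_i)).
    by apply: total_or_pair => [s|]; rewrite ?vanish_total // !leq_max leqnn.
  rewrite -/(map _ _) -map_comp => /mapP[[j l]].
  rewrite mem_filter => /andP[/= ne_jl _] ->.
  rewrite /= big_nil mul1r !big_cons big_nil mulr1 /= !ubit_polyE.
  rewrite -(eval_pair (@mpolyC n 'F_q) (fun _ => 'X_i)).
  apply: total_or_pair => [s|]; rewrite ?vanish_pair // !leq_max.
  by rewrite (leq_bigmax (j, l)) ?orbT.
- rewrite map_flatten -map_comp => /flatten_mapP[g _] /=; rewrite /gate_eqs.
  case def_g: (node_at C g) => [//|//|o us].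
  rewrite map_allpairs => /allpairsP[[i cl] /= [+ + ->]].
  rewrite mem_iota mem_enum /= => lt_i T_cl.
  have [N [a [smallN lt_a bitsE]]] := binary_bitsE def_g lt_i.
  apply: (@derivable_leq _ _ _ (14 + esize (witness (eq_clause o cl)))).
    rewrite leq_add2l /witness_bound !leq_max.
    by case: (o); rewrite (leq_bigmax cl) ?orbT.
  rewrite /= !big_map.
  under eq_bigr do rewrite bitsE.
  under [X in _ * X]eq_bigr do rewrite bitsE.
  rewrite -eval_clause; apply: (derivable_vanishing q_prime C_wf) => // s.
  exact: vanish_clause (T_ok o) T_cl.
- rewrite map_allpairs => /allpairsP[[u j] /= [/bnode_nodepoly + _ ->]].
  case=> N [k [smallN lt_k ->]].
  apply: (@derivable_leq _ _ _ (14 + esize (witness (eq_boolean j)))).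
    by rewrite leq_add2l /witness_bound !leq_max (leq_bigmax j) ?orbT.
  rewrite ubit_polyE -(eval_boolean (@mpolyC n 'F_q) (fun _ => nodepoly N k)).
  apply: (derivable_vanishing q_prime C_wf) => // s.
  exact: vanish_boolean.
rewrite -map_comp => /mapP[j _ ->] /=.
rewrite node_bitsE; last by case/andP: C_wf.
apply: (@derivable_leq _ _ _ (14 + esize (eq_out j))).
  rewrite leq_add2l /witness_bound !leq_max.
  by rewrite (leq_bigmax (F := fun j => esize (eq_out j)) j) ?orbT.
rewrite -(eval_out (@mpolyC n 'F_q) (fun _ => cpoly C)).
by apply: derivable_out => //; apply: vanish_out.
Qed.

End Equations.

(* Assembling the bounds *)
Local Close Scope ring_scope.

Theorem theorem6p10 (q : nat) (q_prime : prime q) :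
  exists c e : nat,
  forall (T : gate_op -> cnf3 q) (T_ok : forall o, truth_table_cnf o (T o))
    (n : nat) (C : circuit 'F_q n) (C_wf : circuit_wf C)
    (p : {mpoly 'F_q[n]}),
  p \in scnf C T ->
  exists D : circuit 'F_q (n + size (circuit_axioms C)),
    [/\ circuit_wf D,
        ips_alg_proof (circuit_axioms C) p D,
        csize D <= c * csize C ^ e
      & cdepth D <= c * (cdepth C).+1].
Proof.
(* The size is linear in that of [C], so the exponent is 1. *)
exists (14 + witness_bound q), 1 => T T_ok n C C_wf p C_p.
by rewrite expn1; apply: scnf_derivable T_ok C_p.
Qed.
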